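(* Let $T$ be a tree, let $\mathcal{Q}=\{Q_1,\ldots,Q_m\}$ be a set of $m$ vertex disjoint paths covering $T$, and let $\theta$ be a real number. Then the following are equivalent: (i) $m$ is the maximum multiplicity of a root of the matching polynomial $\mu(T,x)$ and $\theta$ is a root attaining it, i.e. $\mathrm{mult}(\theta,T)=m$; (ii) $\mathcal{Q}$ is $(\theta,T)$-extremal.
   Context: All graphs are finite and simple. For a graph $G$ on $n$ vertices, the matching polynomial is $\mu(G,x)=\sum_{k\ge 0}(-1)^k p(G,k)x^{n-2k}$, where $p(G,k)$ is the number of matchings (sets of pairwise disjoint edges) with exactly $k$ edges in $G$ (so $p(G,0)=1$, and the empty graph has matching polynomial $1$). All its roots are real. $\mathrm{mult}(\theta,G)$ denotes the multiplicity of $\theta$ as a root of $\mu(G,x)$ (equal to $0$ if $\theta$ is not a root). $G\setminus u$ is the graph obtained from $G$ by deleting the vertex $u$ and all edges incident to it. A vertex $u$ of $G$ is $\theta$-essential in $G$ if $\mathrm{mult}(\theta,G\setminus u)=\mathrm{mult}(\theta,G)-1$. A vertex $u$ is $\theta$-special in $G$ if it is not $\theta$-essential in $G$ but has a neighbor in $G$ that is $\theta$-essential in $G$. A set of vertex disjoint paths covers $G$ if the paths are (nonempty) path subgraphs of $G$, possibly consisting of a single vertex, such that every vertex of $G$ lies in exactly one of them. Such a set $\mathcal{Q}=\{Q_1,\ldots,Q_m\}$ is $(\theta,G)$-extremal if: (a) $\theta$ is a root of $\mu(Q_i,x)$ for all $i=1,\ldots,m$; and (b) for every edge $\{u,v\}\in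 E(G)$ with $u\in V(Q_r)$, $v\in V(Q_s)$, $r\ne s$, either $u$ is $\theta$-special in $Q_r$ or $v$ is $\theta$-special in $Q_s$ (inclusive or; specialness is with respect to the path $Q_r$, resp. $Q_s$, regarded as a graph by itself). *)

(* Defs.v *)
From HB Require Import structures.
From mathcomp Require Import all_boot all_order all_algebra.
From mathcomp Require Import reals.

Set Implicit Arguments.
Unset Strict Implicit.
Unset Printing Implicit Defensive.

Import GRing.Theory.
Local Open Scope ring_scope.

Section Graphs.
Variable V : finType.
Implicit Types (u v : V).

(* Finite simple graphs whose vertices lie in the ambient finite type V, as
   pairs (vertex set, edge set); graphs on different vertex sets share one type,
   which makes subgraphs and vertex deletion elementary. *)
Record graph := Graph {
  gval : {set V} * {set {set V}};
  gvalP : [forall f in gval.2, (#|f| == 2%N) && (f \subset gval.1)]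
}.

HB.instance Definition _ := [isSub for gval].
HB.instance Definition _ := [Finite of graph by <:].

Implicit Types (G H : graph).

Definition vert G : {set V} := (gval G).1.
Definition edges G : {set {set V}} := (gval G).2.

(* Irreflexive, since an edge has exactly two elements. *)
Definition adj G : rel V := fun u v => [set u; v] \in edges G.

Definition subgraph H G : bool :=
  (vert H \subset vert G) && (edges H \subset edges G).

Fact del_vertex_subproof G u :
  [forall f in [set f in edges G | u \notin f],
     (#|f| == 2%N) && (f \subset vert G :\ u)].
Proof.
apply/forall_inP => f; rewrite inE => /andP[fG uf].
have /andP[-> fV] := forall_inP (gvalP G) f fG.
by rewrite subsetD1 fV uf.
Qed.

Definition del_vertex G u : graph :=
  @Graph (vert G :\ u, [set f in edges G | u \notin f]) (del_vertex_subproof G u).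

Definition connected G : Prop :=
  vert G != set0 /\ {in vert G &, forall u v, connect (adj G) u v}.

Definition acyclic G : Prop :=
  forall c : seq V, ucycle (adj G) c -> (size c <= 2)%N.

Definition is_tree G : Prop := connected G /\ acyclic G.

(* The distinct vertices x :: p in order, with exactly the consecutive pairs as
   edges; a single vertex (p = [::]) is allowed. *)
Definition is_path_graph G : Prop :=
  exists x p, [/\ uniq (x :: p), vert G = [set:: x :: p]
    & edges G = [set:: pairmap (fun u v => [set u; v]) x p]].

Definition path_cover G (Q : {set graph}) : Prop :=
  (forall P, P \in Q -> is_path_graph P /\ subgraph P G) /\
  (forall v, v \in vert G -> exists! P, P \in Q /\ v \in vert P).

Definition matching G (M : {set {set V}}) : bool :=
  (M \subset edges G) && trivIset M.

Definition num_matchings G (k : nat) : nat :=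
  #|[set M : {set {set V}} | matching G M & #|M| == k]|.

Section Roots.
Variable R : realType.
Implicit Types (theta : R).

(* A matching with k edges covers 2k vertices, so num_matchings G k = 0 beyond
   the range of this sum. *)
Definition match_poly G : {poly R} :=
  \sum_(k < (#|vert G|./2).+1)
    ((-1) ^+ k * (num_matchings G k)%:R) *: 'X^(#|vert G| - 2 * k).

Definition mult theta G : nat := mup theta (match_poly G).

(* mult(theta, G \ u) = mult(theta, G) - 1, with the subtraction moved to the
   other side because subtraction on nat truncates at 0. *)
Definition essential theta G u : bool :=
  (u \in vert G) && ((mult theta (del_vertex G u)).+1 == mult theta G).

Definition special theta G u : bool :=
  [&& u \in vert G, ~~ essential theta G u
    & [exists v, adj G u v && essential theta G v]].

Definition extremal theta G (Q : {set graph}) : Prop :=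
  (forall P, P \in Q -> root (match_poly P) theta) /\
  (forall P P' u v, P \in Q -> P' \in Q -> P != P' ->
     u \in vert P -> v \in vert P' -> adj G u v ->
     special theta P u || special theta P' v).

Definition max_root_mult (p : {poly R}) (m : nat) : Prop :=
  (exists2 t, root p t & mup t p = m) /\
  (forall t, root p t -> (mup t p <= m)%N).

End Roots.
End Graphs.

(* Main.v *)
(** Give every vertex of the tree a rank so that each vertex has at most one
    higher-ranked neighbour, its parent. Eliminating vertices from the lowest upwards shows
    that mu(T, x) is the product over v of f_v(x) = x - sum of 1/f_c(x) over the children c
    of v. At theta each f_v is increasing, so its zeros and poles there are simple, and
    mult(theta, T) is the number of vertices with value 0 minus the number with value
    infinity. A vertex has value infinity exactly when one of its children has value 0.
    On a path of the cover, each zero other than the top vertex is thus charged to an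
    infinite parent, so a path contributes at most 1 and mult(theta, T) <= m for every
    theta. In case of equality on a path, its top vertex has value 0 or infinity and every
    infinite vertex already has a zero child inside the path. When theta is a root of a
    path, its special vertices are exactly those of value infinity with respect to the path
    alone. By induction on the rank, both (i) and (ii) force the values computed in T and in
    the paths of the cover to agree, and then both say that every path contributes 1. *)

Require Import Defs.
From mathcomp Require Import all_boot all_order all_algebra.
From mathcomp Require Import reals.
From mathcomp Require Import zify ring lra.

Set Implicit Arguments.
Unset Strict Implicit.
Unset Printing Implicit Defensive.

Import Order.TTheory GRing.Theory Num.Theory.
Local Open Scope ring_scope.

(** * Weighted matching sums *)

Section GraphBasics.
Variable V : finType.
Implicit Types (G H : graph V) (u v : V).

Lemma edgeP G f : f \in edges G -> #|f| = 2 /\ f \subset vert G.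
Proof. by move=> fG; have /andP[/eqP-> ->] := forall_inP (gvalP G) f fG. Qed.

Lemma edge_other G f p : f \in edges G -> p \in f -> exists q, f = [set p; q].
Proof.
move=> /edgeP[f2 _] pf.
have /card_gt0P[q] : (0 < #|f :\ p|)%N by move: f2; rewrite (cardsD1 p) pf add1n => -[->].
rewrite !inE => /andP[qp qf]; exists q; apply/esym/eqP.
by rewrite eqEcard f2 cards2 eq_sym qp subUset !sub1set pf qf.
Qed.

Lemma adjC G : symmetric (adj G).
Proof. by move=> u v; rewrite /adj setUC. Qed.

Lemma adj_neq G u v : adj G u v -> u != v.
Proof. by move=> /edgeP[]; rewrite cards2; case: (u != v). Qed.

Lemma adj_vertl G u v : adj G u v -> u \in vert G.
Proof. by move=> /edgeP[_ /subsetP->] //; rewrite set21. Qed.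

Lemma adj_vertr G u v : adj G u v -> v \in vert G.
Proof. by rewrite adjC; apply: adj_vertl. Qed.

Lemma subgraph_adj H G u v : subgraph H G -> adj H u v -> adj G u v.
Proof. by case/andP=> _ /subsetP; apply. Qed.

Lemma subgraph_vert H G u : subgraph H G -> u \in vert H -> u \in vert G.
Proof. by case/andP=> /subsetP + _; apply. Qed.

Lemma adj_del G w u v :
  adj (del_vertex G w) u v = [&& adj G u v, u != w & v != w].
Proof. by rewrite /adj inE !inE negb_or ![w == _]eq_sym. Qed.

Lemma in_vert_del G w u : (u \in vert (del_vertex G w)) = (u != w) && (u \in vert G).
Proof. by rewrite !inE. Qed.

Lemma subgraph_del G w : subgraph (del_vertex G w) G.
Proof.
by apply/andP; split; [apply: subD1set | apply/subsetP=> f; rewrite inE => /andP[]].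
Qed.

Lemma card_vert_del G w : w \in vert G -> #|vert G| = #|vert (del_vertex G w)|.+1.
Proof. by move=> wG; rewrite (cardsD1 w) wG. Qed.

Lemma coverU1 (e : {set V}) N : cover (e |: N) = e :|: cover N.
Proof. by rewrite /cover bigcup_setU big_set1. Qed.

Lemma matching_cover G M : matching G M -> cover M \subset vert G.
Proof.
case/andP=> /subsetP ME _; apply/bigcupsP => f fM.
by case: (edgeP (ME f fM)).
Qed.

Lemma matching_card_cover G M : matching G M -> #|cover M| = (2 * #|M|)%N.
Proof.
case/andP=> /subsetP ME /eqP <-.
rewrite (eq_bigr (fun=> 2%N)); last by move=> f /ME /edgeP[].
by rewrite sum_nat_const mulnC.
Qed.

Lemma matching_del G p M :
  matching (del_vertex G p) M = matching G M && (p \notin cover M).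
Proof.
rewrite /matching; case: (trivIset M); rewrite ?andbF ?andbT //.
apply/subsetP/andP => [ME | [/subsetP ME pM] f fM].
  split; first by apply/subsetP=> f /ME; rewrite inE => /andP[].
  by apply/bigcupP=> -[f /ME]; rewrite inE => /andP[_ /negP].
rewrite inE ME //=; apply: contra pM => pf.
by apply/bigcupP; exists f.
Qed.

(** Adding the edge turns matchings that avoid both ends into matchings through it. The last
    conjunct makes this insertion injective. *)
Lemma matching_edge G p q M : adj G p q ->
  matching (del_vertex (del_vertex G p) q) M =
  matching G ([set p; q] |: M) && ([set p; q] \notin M).
Proof.
move=> pq; rewrite !matching_del.
apply/andP/andP=> [[/andP[/andP[ME tM] pM] qM] | [/andP[ME tM] eM]].
  have eM : [set p; q] \notin M.
    apply: contra pM => eM; apply/bigcupP; exists [set p; q] => //.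
    by rewrite set21.
  split=> //; apply/andP; split; first by rewrite subUset sub1set -/(adj G p q) pq.
  have: trivIset (M :|: [set [set p; q]]).
    apply: trivIsetU => //; first exact: trivIset1.
    rewrite /cover big_set1 disjoint_sym disjoint_subset.
    by apply/subsetP=> x; rewrite !inE => /orP[] /eqP->.
  by rewrite setUC.
have sub : M \subset [set p; q] |: M by apply: subsetUr.
have no x : x \in [set p; q] -> x \notin cover M.
  move=> xe; apply/bigcupP=> -[f fM xf].
  have /trivIsetP/(_ [set p; q] f) := tM.
  rewrite setU11 (subsetP sub) // => /(_ isT isT).
  have -> : [set p; q] != f by apply: contraNneq eM => ->.
  move=> /(_ isT) /pred0P /(_ x); rewrite /= xe xf; done.
split; last by apply: no; rewrite set22.
apply/andP; split; last by apply: no; rewrite set21.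
apply/andP; split; first exact: subset_trans ME.
exact: trivIsetS tM.
Qed.

End GraphBasics.

Section WeightedMatchings.
Variables (V : finType) (K : comNzRingType).
Implicit Types (G : graph V) (w : V -> K).

(** Weights vary with the vertex because eliminating a vertex alters the weight of its neighbour;
    constant weight ['X] gives the matching polynomial. *)
Definition wmatch G w : K :=
  \sum_(M : {set {set V}} | matching G M)
     (-1) ^+ #|M| * \prod_(v in vert G :\: cover M) w v.

Lemma eq_wmatch G w w' : {in vert G, w =1 w'} -> wmatch G w = wmatch G w'.
Proof.
move=> ww'; apply: eq_bigr => M _; congr (_ * _); apply: eq_bigr => v.
by rewrite inE => /andP[_ /ww'].
Qed.

(** Matchings are split by whether they cover [p], and those that do by the partner of [p]. *)
Lemma wmatch_rec G w p : p \in vert G ->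
  wmatch G w = w p * wmatch (del_vertex G p) w
    - \sum_(q | adj G p q) wmatch (del_vertex (del_vertex G p) q) w.
Proof.
move=> pG; rewrite /wmatch (bigID (fun M => p \in cover M)) /= addrC.
congr (_ + _).
  rewrite mulr_sumr; apply: eq_big => [M|M /andP[_ pM]].
    by rewrite matching_del.
  rewrite mulrCA; congr (_ * _).
  rewrite (bigD1 p) /=; last by rewrite inE pM.
  congr (_ * _); apply: eq_bigl => v; rewrite !inE.
  by case: (v == p); rewrite ?andbF ?andbT.
(* [h M] is the partner of [p] in [M]; the default [p] does not arise for a matching that covers
   [p]. *)
pose h (M : {set {set V}}) : V := odflt p [pick q | [set p; q] \in M].
have hP M q : matching G M -> adj G p q ->
    (p \in cover M) && (h M == q) = ([set p; q] \in M).
  move=> mM pq; apply/andP/idP => [[/bigcupP[f fM pf] /eqP <-]|qM].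
    rewrite /h; case: pickP => //= no.
    have [x fE] := edge_other (subsetP (andP mM).1 f fM) pf.
    by have := no x; rewrite -fE fM.
  split; first by apply/bigcupP; exists [set p; q]; rewrite ?set21.
  rewrite /h; case: pickP => [x xM|/(_ q)] /=; last by rewrite qM.
  have /trivIsetP/(_ _ _ xM qM) := (andP mM).2.
  case: (altP ([set p; x] =P [set p; q])) => [E _|_ /(_ isT) /pred0P/(_ p)]; last first.
    by rewrite /= !set21.
  have := set22 p q; rewrite -E !inE (negbTE (_ : q != p)) /=; first by rewrite eq_sym.
  by rewrite eq_sym (adj_neq pq).
rewrite (partition_big h (adj G p)) /=; last first.
  move=> M /andP[mM pM]; rewrite /h; case: pickP => [q qM|no] /=.
    exact: (subsetP (andP mM).1 _ qM).
  case/bigcupP: pM => f fM pf.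
  have [x fE] := edge_other (subsetP (andP mM).1 f fM) pf.
  by have := no x; rewrite -fE fM.
rewrite -sumrN; apply: eq_bigr => q pq.
rewrite (reindex_onto (fun N => [set p; q] |: N) (fun M => M :\ [set p; q])) /=; last first.
  by move=> M /andP[/andP[mM pM] hM]; rewrite setD1K // -(hP M q) ?pM.
rewrite -sumrN; apply: eq_big => [N|N].
  rewrite matching_edge //.
  case mN: (matching G ([set p; q] |: N)) => //=.
  rewrite hP // setU11 /=.
  apply/eqP/idP => [E|eN]; first by rewrite -E setD11.
  by rewrite setU1K.
case/andP=> /andP[/andP[mN _] _] /eqP E.
have eN : [set p; q] \notin N by rewrite -E setD11.
rewrite cardsU1 eN exprD expr1 mulN1r mulNr; congr (- (_ * _)).
apply: eq_bigl => v; rewrite coverU1 !inE !negb_or.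
by case: (v == p); case: (v == q); rewrite ?andbF ?andbT.
Qed.

End WeightedMatchings.

Lemma match_poly_wmatch (V : finType) (R : realType) (G : graph V) :
  match_poly R G = wmatch G (fun=> 'X).
Proof.
have cM M : matching G M -> #|vert G :\: cover M| = (#|vert G| - 2 * #|M|)%N.
  by move=> mM; rewrite cardsDS ?(matching_cover mM) // (matching_card_cover mM).
have leM M : matching G M -> (#|M| < (#|vert G|./2).+1)%N.
  move=> mM; have := subset_leq_card (matching_cover mM).
  by rewrite (matching_card_cover mM) => ?; lia.
(* Matchings are grouped by size; by [leM] the size is in range, so [inord] keeps it. *)
rewrite /wmatch (partition_big (fun M : {set {set V}} => inord #|M| : 'I_(#|vert G|./2).+1) xpredT) //=.
apply: eq_bigr => k _.
rewrite (eq_bigr (fun=> (-1) ^+ k * 'X^(#|vert G| - 2 * k))); last first.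
  move=> M /andP[mM /eqP <-]; rewrite inordK ?leM //.
  by rewrite prodr_const cM.
rewrite sumr_const -mul_polyC polyCM rmorphXn rmorphN1 polyC_natr.
rewrite mulr_natr mulrnAl; congr (_ *+ _).
apply: eq_card => M; rewrite !inE unfold_in /=.
have [mM|] //= := boolP (matching G M).
by rewrite -val_eqE /= inordK ?leM.
Qed.

(** * Ranks, recursion along them, and elimination of vertices *)

Section Ranks.
Variable V : finType.
Implicit Types (G H : graph V) (r : V -> nat) (u v : V).

Definition up r G : rel V := fun u v => adj G u v && (r u < r v)%N.

(** A rooted forest without an explicit parent function: [up r G u v] says that [v] is the parent of
    [u]. In this form it passes to subgraphs. *)
Definition ranked r G : Prop :=
  (forall u v, adj G u v -> r u != r v) /\
  (forall u v w, up r G u v -> up r G u w -> v = w).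

Lemma subgraph_up r H G u v : subgraph H G -> up r H u v -> up r G u v.
Proof. by rewrite /up => HG /andP[/(subgraph_adj HG)-> ->]. Qed.

Lemma subgraph_ranked r H G : subgraph H G -> ranked r G -> ranked r H.
Proof.
move=> HG [neq uniq]; split=> [u v /(subgraph_adj HG)/neq //|u v w].
by move=> /(subgraph_up HG) uv /(subgraph_up HG) /(uniq _ _ _ uv).
Qed.

Lemma up_del r G w u v :
  up r (del_vertex G w) u v = [&& up r G u v, u != w & v != w].
Proof.
by rewrite /up adj_del; case: (adj G u v); case: (r u < r v)%N; rewrite ?andbT ?andbF.
Qed.

Section Recursion.
Variables (A : Type) (d : A) (r : V -> nat) (step : V -> (V -> A) -> A).

Fixpoint rank_iter n v : A := if n is n'.+1 then step v (rank_iter n') else d.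
Definition rank_rec v := rank_iter (r v).+1 v.

(** The iteration count is fuel: any two amounts above [r v] give the same value at [v], so the
    default [d] is never seen. *)
Lemma rank_recE :
  (forall v g g', (forall u, (r u < r v)%N -> g u = g' u) -> step v g = step v g') ->
  forall v, rank_rec v = step v rank_rec.
Proof.
move=> stepP.
have enough n m v : (r v < n)%N -> (r v < m)%N -> rank_iter n v = rank_iter m v.
  elim: n m v => [|n IH] [|m] //= v rn rm; apply: stepP => u ru.
  by apply: IH; apply: leq_trans ru _.
by move=> v; apply: stepP => u ru; apply: enough.
Qed.

End Recursion.

(* The lowest vertex has at most one neighbour [p]; eliminating it divides out its weight
   and moves the term [(f v)^-1] from the weight of [p], as in a Schur complement. *)
Lemma wmatch_prod (K : fieldType) r G (f : V -> K) : ranked r G ->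
  {in vert G, forall v, f v != 0} ->
  wmatch G (fun v => f v + \sum_(c | up r G c v) (f c)^-1) = \prod_(v in vert G) f v.
Proof.
have [n] := ubnP #|vert G|; elim: n G => // n IH G ltGn rG f0.
have [V0|/set0Pn[v0 v0G]] := eqVneq (vert G) set0.
  rewrite V0 big_set0 /wmatch (big_pred1 set0) => [|M] /=.
    by rewrite cards0 mul1r big1 // => v; rewrite V0 !inE andbF.
  apply/idP/eqP => [/andP[/subsetP ME _]|->].
    apply/setP=> e; rewrite inE; apply/negP=> /ME /edgeP[e2].
    by rewrite V0 subset0 => /eqP e0; rewrite e0 cards0 in e2.
  rewrite /matching sub0set; by apply/trivIsetP => A B; rewrite inE.
pose v := [arg min_(i < v0 in vert G) r i].
have [vG vmin] : v \in vert G /\ forall u, u \in vert G -> (r v <= r u)%N.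
  by rewrite /v; case: arg_minnP.
have upv q : adj G v q -> up r G v q.
  by move=> vq; rewrite /up vq ltn_neqAle rG.1 // vmin // (adj_vertr vq).
have noup c : up r G c v = false.
  by apply/negP=> /andP[cv]; rewrite ltnNge vmin // (adj_vertl cv).
pose G' := del_vertex G v.
have rG' : ranked r G' by apply: subgraph_ranked rG; apply: subgraph_del.
have f0' : {in vert G', forall u, f u != 0}.
  by move=> u; rewrite in_vert_del => /andP[_ /f0].
have {}IH : wmatch G' (fun u => f u + \sum_(c | up r G' c u) (f c)^-1)
     = \prod_(u in vert G') f u.
  by apply: IH => //; rewrite -ltnS; apply: leq_trans ltGn; rewrite (card_vert_del vG).
rewrite (bigD1 v) //= (eq_bigl (fun u => u \in vert G')) => [|u]; last first.
  by rewrite in_vert_del andbC.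
rewrite -[X in _ = _ * X]IH.
set w := fun u => _ + _; set w' := fun u => _ + _.
have wv : w v = f v by rewrite /w big_pred0 // addr0.
rewrite (wmatch_rec _ vG) wv -/G'.
have ww' u : u \in vert G' -> ~~ adj G v u -> w u = w' u.
  rewrite in_vert_del /w /w' => /andP[uv _] vu; congr (_ + _).
  apply: eq_bigl => c; rewrite up_del uv andbT.
  by case: eqP => [->|]; rewrite ?andbT // /up (negbTE vu).
have [p vp|nop] := pickP (adj G v); last first.
  rewrite big_pred0 // subr0; congr (_ * _); apply: eq_wmatch => u uG.
  by apply: ww' => //; rewrite nop.
have onlyp q : adj G v q = (q == p).
  by apply/idP/eqP => [vq|->//]; apply: (rG.2 v); apply: upv.
rewrite (big_pred1 p) //.
have pG' : p \in vert G'.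
  by rewrite in_vert_del (adj_vertr vp) eq_sym (adj_neq vp).
have wp : w p = w' p + (f v)^-1.
  rewrite /w /w' (bigD1 v) ?upv //= addrCA [RHS]addrC; congr (_ + (_ + _)).
  apply: eq_bigl => c; rewrite up_del.
  by have := adj_neq vp; rewrite eq_sym => ->; rewrite andbT.
have eqdel u : u \in vert (del_vertex G' p) -> w u = w' u.
  by rewrite in_vert_del => /andP[up uG']; apply: ww' => //; rewrite onlyp.
(* Expanding both sides at [p], the extra [(f v)^-1] in [w p], multiplied by [f v], cancels the
   subtracted term of the edge from [v] to [p]. *)
rewrite !(wmatch_rec _ pG') (eq_wmatch eqdel) wp.
have -> : \sum_(q | adj G' p q) wmatch (del_vertex (del_vertex G' p) q) w
    = \sum_(q | adj G' p q) wmatch (del_vertex (del_vertex G' p) q) w'.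
  by apply: eq_bigr => q _; apply: eq_wmatch => u; rewrite in_vert_del => /andP[_ /eqdel].
by field; apply: f0.
Qed.

End Ranks.

(** * Values at theta *)

Lemma addf_div_common (K : fieldType) (x a1 a2 b1 b2 : K) : x != 0 -> b1 != 0 -> b2 != 0 ->
  a1 / (b1 * x) + a2 / (b2 * x) = (a1 * b2 + a2 * b1) / (x * b1 * b2).
Proof. by move=> x0 b10 b20; field; rewrite x0 b10 b20. Qed.

Section Germs.
Variables (R : realType) (theta : R).
Local Notation tofrac := (@tofrac {poly R}).
Local Notation "p %:F" := (tofrac p).
Implicit Types (p q : {poly R}) (g h : {fraction {poly R}}) (a b : option R).

Definition wronskian p q : {poly R} := p^`() * q - p * q^`().

(* [None] is the value infinity. A positive Wronskian means that [g] is increasing at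
   [theta] as a map to the projective line; it makes zeros and poles at [theta] simple. *)
Definition germ g a : Prop :=
  exists p q, [/\ q != 0, g = p%:F / q%:F, 0 < (wronskian p q).[theta]
    & a = if q.[theta] == 0 then None else Some (p.[theta] / q.[theta])].

(* The reciprocal, with 1/infinity = 0; the junk value at [Some 0] is 0. *)
Definition oinv a : R := if a is Some x then x^-1 else 0.

Lemma hornerW p q : (wronskian p q).[theta] =
  p^`().[theta] * q.[theta] - p.[theta] * q^`().[theta].
Proof. by rewrite /wronskian !hornerE. Qed.

Lemma germ_neq0 g a : germ g a -> g != 0.
Proof.
case=> p [q [q0 -> W _]]; rewrite mulf_neq0 ?invr_eq0 ?tofrac_eq0 //.
by apply: contraTneq W => ->; rewrite hornerW deriv0 horner0 !mul0r subrr ltxx.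
Qed.

Lemma germX : germ ('X%:F) (Some theta).
Proof.
exists 'X, 1; rewrite oner_eq0 tofrac1 divr1 hornerW derivX -polyC1 derivC !hornerC.
by rewrite hornerX oner_eq0 divr1 mulr0 subr0 mulr1 ltr01.
Qed.

(** The pair [(- q, p)] has the same Wronskian as [(p, q)]. *)
Lemma germ_oppinv g a : germ g a ->
  germ (- g^-1) (if a == Some 0 then None else Some (- oinv a)).
Proof.
move=> gP; have g0 := germ_neq0 gP; case: gP => p [q [q0 gE W ->]].
have p0 : p != 0 by apply: contraNneq g0 => p0; rewrite gE p0 tofrac0 mul0r.
exists (- q), p; split=> //.
- by rewrite gE invf_div tofracN mulNr.
- by move: W; rewrite !hornerW derivN !hornerN => W; lra.
have [qt|qt] := eqVneq q.[theta] 0.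
  have pt : p.[theta] != 0.
    by apply: contraTneq W => pt; rewrite hornerW pt qt mulr0 mul0r subrr ltxx.
  by rewrite (negbTE pt) /= hornerN qt oppr0 mul0r.
rewrite (inj_eq Some_inj) mulf_eq0 invr_eq0 (negbTE qt) orbF /=.
by case: eqP => // _; rewrite invf_div hornerN mulNr.
Qed.

(** Two poles cannot cancel, since increasing functions have residues of the same sign. *)
Lemma germ_add g h a b : germ g a -> germ h b ->
  germ (g + h) (if a is Some x then if b is Some y then Some (x + y) else None else None).
Proof.
case=> p1 [q1 [q10 -> W1 ->]] [p2 [q2 [q20 -> W2 ->]]].
have f0 q : q != 0 -> q%:F != 0 by rewrite tofrac_eq0.
(* If both denominators vanish at [theta], over their product the Wronskian would vanish there, so
   the common factor is taken only once. *)
have [/andP[/eqP z1 /eqP z2]|nz] := boolP ((q1.[theta] == 0) && (q2.[theta] == 0)).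
  rewrite z1 z2 eqxx.
  have /factor_theorem[s1 E1] : root q1 theta by apply/rootP.
  have /factor_theorem[s2 E2] : root q2 theta by apply/rootP.
  have x0 : 'X - theta%:P != 0 by rewrite polyXsubC_eq0.
  have s10 : s1 != 0 by apply: contraNneq q10 => s10; rewrite E1 s10 mul0r.
  have s20 : s2 != 0 by apply: contraNneq q20 => s20; rewrite E2 s20 mul0r.
  exists (p1 * s2 + p2 * s1), (('X - theta%:P) * s1 * s2); split.
  - by rewrite !mulf_neq0.
  - move: x0; rewrite E1 E2; move: ('X - _) => x x0.
    by rewrite !(tofracM, tofracD) addf_div_common ?f0.
  - move: W1 W2; rewrite !hornerW E1 E2 !(derivXsubC, derivM, derivD) !hornerE /=.
    set a1 := p1.[_]; set a2 := p2.[_]; set b1 := s1.[_]; set b2 := s2.[_] => W1 W2.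
    have b10 : b1 != 0 by apply: contraTneq W1 => ->; rewrite -leNgt; lra.
    have b20 : b2 != 0 by apply: contraTneq W2 => ->; rewrite -leNgt; lra.
    have P1 : 0 < (- (a1 * b1)) * b2 ^+ 2.
      by rewrite mulr_gt0 ?exprn_even_gt0 ?b20 ?orbT //; lra.
    have P2 : 0 < (- (a2 * b2)) * b1 ^+ 2.
      by rewrite mulr_gt0 ?exprn_even_gt0 ?b10 ?orbT //; lra.
    nra.
  - by rewrite !hornerE subrr !mul0r eqxx.
exists (p1 * q2 + p2 * q1), (q1 * q2); split.
- by rewrite mulf_neq0.
- by rewrite !(tofracM, tofracD) addf_div ?f0.
- move: W1 W2; rewrite !hornerW !(derivM, derivD) !hornerE /=.
  set a1 := p1.[_]; set a2 := p2.[_]; set b1 := q1.[_]; set b2 := q2.[_].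
  set a1' := p1^`().[_]; set a2' := p2^`().[_]; set b1' := q1^`().[_]; set b2' := q2^`().[_].
  move=> W1 W2.
  (* The Wronskian of the sum is the sum of the two Wronskians, each times the square of the other
     denominator; one of these squares is positive. *)
  suff : 0 < (a1' * b1 - a1 * b1') * b2 ^+ 2 + (a2' * b2 - a2 * b2') * b1 ^+ 2.
    by congr (0 < _); ring.
  have s1 := sqr_ge0 b1; have s2 := sqr_ge0 b2.
  move: nz; rewrite negb_and => /orP[] b0.
    have : 0 < b1 ^+ 2 by rewrite lt_def sqrf_eq0 b0.
    by move=> ?; apply: ltr_wpDl; [rewrite mulr_ge0 // ltW | rewrite mulr_gt0].
  have : 0 < b2 ^+ 2 by rewrite lt_def sqrf_eq0 b0.
  by move=> ?; apply: ltr_pwDl; [rewrite mulr_gt0 | rewrite mulr_ge0 // ltW].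
rewrite !hornerE mulf_eq0.
have [//|z1] := eqVneq q1.[theta] 0; have [//|z2] := eqVneq q2.[theta] 0.
by rewrite addf_div.
Qed.

Lemma germ_sub_sum (V : eqType) (s : seq V) (f : V -> {fraction {poly R}}) (c : V -> option R) :
  {in s, forall v, germ (f v) (c v)} ->
  germ ('X%:F - \sum_(v <- s) (f v)^-1)
    (if has (fun v => c v == Some 0) s then None
     else Some (theta - \sum_(v <- s) oinv (c v))).
Proof.
elim: s => [_|v s IH fc]; first by rewrite !big_nil !subr0; apply: germX.
rewrite !big_cons /=.
have {}IH := IH (fun u us => fc u (mem_behead (us : u \in behead (v :: s)))).
have := germ_add (germ_oppinv (fc v (mem_head _ _))) IH.
have -> : - (f v)^-1 + ('X%:F - \sum_(v <- s) (f v)^-1)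
   = 'X%:F - ((f v)^-1 + \sum_(v <- s) (f v)^-1) by ring.
case: (c v == Some 0) => //=; case: (has _ s) => //.
have -> // : - oinv (c v) + (theta - \sum_(v <- s) oinv (c v))
   = theta - (oinv (c v) + \sum_(v <- s) oinv (c v)) by ring.
Qed.

(** A common zero or a multiple zero at [theta] would annihilate the Wronskian, so the value alone
    determines both multiplicities. *)
Lemma germ_mup g a : germ g a -> exists pq : {poly R} * {poly R},
  [/\ pq.1 != 0, pq.2 != 0, g = pq.1%:F / pq.2%:F, mup theta pq.1 = (a == Some 0)
    & mup theta pq.2 = (a == None)].
Proof.
move=> gP; have g0 := germ_neq0 gP; case: gP => p [q [q0 gE W ->]].
have p0 : p != 0 by apply: contraNneq g0 => p0; rewrite gE p0 tofrac0 mul0r.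
have simple_root (s : {poly R}) : s != 0 -> s^`().[theta] != 0 -> root s theta -> mup theta s = 1%N.
  move=> s0 ds rs; apply/eqP; rewrite eqn_leq -XsubC_dvd // dvdp_XsubCl rs andbT.
  rewrite mup_leq //; apply: contraNN ds => /dvdpP[t ->].
  by apply/eqP; rewrite derivM deriv_exp /= derivXsubC !hornerE /= subrr; ring.
exists (p, q) => /=; split=> //.
  have [qt|qt] := eqVneq q.[theta] 0.
    rewrite mupNroot //; apply: contraTN W => /rootP pt.
    by rewrite hornerW pt qt mulr0 mul0r subrr ltxx.
  rewrite (inj_eq Some_inj) mulf_eq0 invr_eq0 (negbTE qt) orbF.
  case: eqP => [pt|/eqP pt]; last by rewrite mupNroot.
  rewrite simple_root //; last exact/rootP.
  by apply: contraTneq W => dp; rewrite hornerW dp pt !mul0r subrr ltxx.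
have [qt|qt] := eqVneq q.[theta] 0; last by rewrite mupNroot.
rewrite simple_root //; last exact/rootP.
by apply: contraTneq W => dq; rewrite hornerW dq qt !mulr0 subrr ltxx.
Qed.

End Germs.

(** * Multiplicity as the number of zeros minus the number of poles *)

Section Values.
Variables (R : realType) (theta : R) (V : finType) (r : V -> nat).
Implicit Types (G : graph V) (u v : V).

Definition rval_step G v (a : V -> option R) : option R :=
  if [exists c, up r G c v && (a c == Some 0)] then None
  else Some (theta - \sum_(c | up r G c v) oinv (a c)).

(* The value at [theta] of mu(G_v, x) / mu(G_v \ v, x), where G_v is spanned by [v] and
   its descendants. *)
Definition rval G : V -> option R := rank_rec None r (rval_step G).

Lemma eq_rval_step G v (a a' : V -> option R) :
  (forall c, up r G c v -> a c = a' c) -> rval_step G v a = rval_step G v a'.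
Proof.
move=> aa'; rewrite /rval_step.
have -> : [exists c, up r G c v && (a c == Some 0)] =
          [exists c, up r G c v && (a' c == Some 0)].
  by apply: eq_existsb => c; case: (boolP (up r G c v)) => //= /aa' ->.
by congr (if _ then _ else Some (_ - _)); apply: eq_bigr => c /aa' ->.
Qed.

Lemma rvalE G v : rval G v = rval_step G v (rval G).
Proof.
apply: rank_recE => {}v g g' gg'.
by apply: eq_rval_step => c /andP[_ /gg'].
Qed.

Lemma rval_up G c v : up r G c v -> rval G c = Some 0 -> rval G v = None.
Proof.
move=> cv c0; rewrite rvalE /rval_step.
by case: existsP => // -[]; exists c; rewrite cv c0 eqxx.
Qed.

(** Multiplicities at [theta] are compared in the product formula of [wmatch_prod]. The poles stand
    on the left because subtraction on [nat] truncates. *)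
Lemma match_poly_rval G : ranked r G -> match_poly R G != 0 /\
  (mult theta G + #|[set v in vert G | rval G v == None]| =
   #|[set v in vert G | rval G v == Some 0%R]|)%N.
Proof.
move=> rG.
(* The rational functions f_v themselves; [rval] follows the same recursion at [theta]. *)
pose f : V -> {fraction {poly R}} := rank_rec 0 r (fun v g => tofrac 'X - \sum_(c | up r G c v) (g c)^-1).
have fE v : f v = tofrac 'X - \sum_(c | up r G c v) (f c)^-1.
  apply: rank_recE => {}v g g' gg'.
  by congr (_ - _); apply: eq_bigr => c /andP[_ /gg' ->].
have fP v : germ theta (f v) (rval G v).
  have [n] := ubnP (r v); elim: n v => // n IH v; rewrite ltnS => rv.
  rewrite fE rvalE /rval_step -big_enum -[\sum_(c | _) oinv _]big_enum /=.
  have -> : [exists c, up r G c v && (rval G c == Some 0)] =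
     has (fun c => rval G c == Some 0) (enum (fun c => up r G c v)).
    apply/existsP/hasP => [[c /andP[cv c0]]|[c]]; first by exists c; rewrite ?mem_enum.
    by rewrite mem_enum => cv c0; exists c; rewrite [up _ _ _ _]cv.
  apply: germ_sub_sum => c; rewrite mem_enum => /andP[_ rc].
  by apply: IH; apply: leq_trans rv.
have [pq pqP] := fin_all_exists (fun v => germ_mup (fP v)).
(* Clearing denominators leaves an identity of polynomials, to which additivity of [mup] applies. *)
have E : match_poly R G * \prod_(v in vert G) (pq v).2 = \prod_(v in vert G) (pq v).1.
  apply/eqP; rewrite -tofrac_eq tofracM.
  have -> : tofrac (match_poly R G) = \prod_(v in vert G) f v.
    rewrite -(wmatch_prod rG) => [|v _]; last exact: germ_neq0 (fP v).
    rewrite match_poly_wmatch rmorph_sum; apply: eq_bigr => M _.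
    rewrite rmorphM rmorphXn rmorphN1 rmorph_prod; congr (_ * _).
    by apply: eq_bigr => v _; rewrite {1}fE subrK.
  rewrite !rmorph_prod -big_split /=; apply/eqP; apply: eq_bigr => v _.
  by have [_ q0 -> _ _] := pqP v; rewrite mulfVK // tofrac_eq0.
have prod0 (F : V -> {poly R}) : (forall v, F v != 0) -> \prod_(v in vert G) F v != 0.
  by move=> F0; rewrite prodf_seq_neq0; apply/allP => v _; rewrite F0 implybT.
have p0 : \prod_(v in vert G) (pq v).1 != 0 by apply: prod0 => v; have [] := pqP v.
have q0 : \prod_(v in vert G) (pq v).2 != 0 by apply: prod0 => v; have [] := pqP v.
have m0 : match_poly R G != 0 by apply: contraNneq p0 => m0; rewrite -E m0 mul0r.
split=> //.
have mup_prod (F : V -> {poly R}) (P : pred V) : (forall v, F v != 0) ->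
    (forall v, mup theta (F v) = P v) ->
    mup theta (\prod_(v in vert G) F v) = #|[set v in vert G | P v]|.
  move=> F0 FP.
  have -> : #|[set v in vert G | P v]| = (\sum_(v in vert G) P v)%N.
    rewrite -sum1dep_card big_mkcondr; apply: eq_bigr => v _.
    by case: (P v).
  suff : \prod_(v in vert G) F v != 0 /\
    mup theta (\prod_(v in vert G) F v) = (\sum_(v in vert G) P v)%N by case.
  elim/big_rec2: _ => [|v n p _ [p'0 IHp]].
    by rewrite oner_eq0 mupNroot // root1.
  by rewrite mulf_neq0 // mupM // FP IHp.
have := congr1 (mup theta) E; rewrite mupM // /mult.
rewrite (mup_prod _ (fun v => rval G v == None)); last 2 first.
- by move=> v; have [] := pqP v.
- by move=> v; have [] := pqP v.
rewrite (mup_prod _ (fun v => rval G v == Some 0)) // => v; by have [] := pqP v.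
Qed.

End Values.

(** * Ranks of acyclic graphs *)

Section AcyclicRank.
Variable V : finType.
Implicit Types (G H : graph V) (u v : V).

Lemma subgraph_acyclic H G : subgraph H G -> acyclic G -> acyclic H.
Proof.
move=> HG aG c /andP[cyc uc]; apply: aG; rewrite /ucycle uc andbT.
by apply: sub_cycle cyc => u v; apply: subgraph_adj.
Qed.

(** Degree at most one, so isolated vertices count as leaves. *)
Definition leaf G v := [forall p, forall q, adj G v p && adj G v q ==> (p == q)].

(* Without a leaf, every simple path could be extended at its head: the first vertex has a
   neighbour other than the second one, and it lies off the path by acyclicity. *)
Lemma acyclic_leaf G : acyclic G -> vert G != set0 -> exists2 v, v \in vert G & leaf G v.
Proof.
move=> aG /set0Pn[v0 v0G].
have [v /andP[vG lv]|nol] := pickP [pred v | (v \in vert G) && leaf G v]; first by exists v.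
have other v : v \in vert G -> forall y, exists2 z, adj G v z & z != y.
  move=> vG y; have := nol v; rewrite /= vG /= => /negbT.
  rewrite negb_forall => /existsP[p]; rewrite negb_forall => /existsP[q].
  rewrite negb_imply -andbA => /and3P[vp vq pq].
  have [py|py] := eqVneq p y; last by exists p.
  by exists q => //; rewrite -py eq_sym.
have long n : exists x p, [/\ uniq (x :: p), path (adj G) x p, x \in vert G & size p = n].
  elim: n => [|n [x [p [up pp xG sp]]]]; first by exists v0, [::].
  (* For a path of one vertex the default of [head] is [x] itself, which is not its own neighbour
     anyway. *)
  have [z xz zy] := other x xG (head x p).
  exists z, (x :: p); split=> //; last 2 first.
  - exact: adj_vertr xz.
  - by rewrite /= sp.
  - rewrite cons_uniq up andbT inE eq_sym (negbTE (adj_neq xz)) /=.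
    apply/negP => zp; case/path.splitP: zp up pp zy => p1 p2.
    rewrite -cat_cons cat_uniq cat_path => /andP[up1 _] /andP[pp1 _] zy.
    (* The path from [x] to [z] closes up; having at most two vertices, it would make [z] the second
       vertex, against the choice of [z]. *)
    have /aG : ucycle (adj G) (x :: rcons p1 z).
      by rewrite /ucycle up1 /= rcons_path pp1 last_rcons adjC xz.
    rewrite /= size_rcons; case: p1 zy {up1 pp1} => //=; by rewrite eqxx.
  by rewrite /= adjC xz.
have [x [p [up _ _ sp]]] := long #|V|.
by have := max_card (mem (x :: p)); rewrite (card_uniqP up) /= sp ltnn.
Qed.

(** Leaves are stripped one by one: the removed leaf gets rank 0 and all other ranks rise by one, so
    its neighbour, if any, becomes its parent. *)
Lemma acyclic_ranked G : acyclic G -> exists r, ranked r G.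
Proof.
have [n] := ubnP #|vert G|; elim: n G => // n IH G ltGn aG.
have [V0|V0] := eqVneq (vert G) set0.
  by exists (fun=> 0%N); split=> [u v|u v w /andP[]] /adj_vertl; rewrite V0 inE.
have [v vG lv] := acyclic_leaf aG V0.
have [||r rP] := IH (del_vertex G v).
- by rewrite -ltnS; apply: leq_trans ltGn; rewrite (card_vert_del vG).
- exact: subgraph_acyclic (subgraph_del G v) aG.
exists (fun u => if u == v then 0%N else (r u).+1); split=> [x y xy|x y z].
  have [xv|xv] := eqVneq x v; have [yv|yv] := eqVneq y v => //.
    by have := adj_neq xy; rewrite xv yv eqxx.
  by rewrite eqSS rP.1 // adj_del xy xv.
rewrite /up; have [->|xv] := eqVneq x v => /andP[xy +] /andP[xz +].
  by move=> _ _; apply/eqP; have /forallP/(_ y)/forallP/(_ z) := lv; rewrite xy xz.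
case: eqVneq => // yv; case: eqVneq => // zv; rewrite !ltnS => ry rz.
by apply: (rP.2 x); rewrite up_del xv /up ?xy ?xz ?ry ?rz ?yv ?zv.
Qed.

End AcyclicRank.

(** * Paths *)

Section PathShape.
Variable V : finType.
Implicit Types (P : graph V) (s : seq V) (r : V -> nat) (u v t : V).

(** Adjacency is expressed through positions, which turns arguments on paths into arithmetic of
    indices. *)
Definition path_seq P s : Prop :=
  [/\ uniq s, vert P = [set:: s] & forall u v, adj P u v =
   [&& u \in s, v \in s &
     (index u s == (index v s).+1) || (index v s == (index u s).+1)]].

Lemma path_graph_seq P : is_path_graph P -> exists s, path_seq P s.
Proof.
case=> x [p [us Vs Es]]; exists (x :: p); split=> // u v.
set s := x :: p in us Vs *.
rewrite /adj Es inE; apply/(nthP set0)/idP => [[i]|/and3P[uS vS]].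
  rewrite size_pairmap => ip; rewrite (nth_pairmap x) // -[nth x p i]/(nth x s i.+1).
  rewrite -/s => E.
  have ii : (i < size s)%N by rewrite ltnS ltnW.
  have uE : u \in [set nth x s i; nth x s i.+1] by rewrite E set21.
  have vE : v \in [set nth x s i; nth x s i.+1] by rewrite E set22.
  have uv : u != v.
    apply/eqP => uv; have := cards2 (nth x s i) (nth x s i.+1).
    by rewrite E uv setUid cards1 nth_uniq // neq_ltn ltnSn.
  by move: uE vE uv; rewrite !in_set2 => /orP[]/eqP-> /orP[]/eqP->;
    rewrite ?eqxx // => _; rewrite !mem_nth // !index_uniq // eqxx ?orbT.
have xi w : w \in s -> nth x s (index w s) = w by exact: nth_index.
have key a b : a \in s -> b \in s -> index b s = (index a s).+1 ->
    (index a s < size (pairmap (fun u v => [set u; v]) x p))%N /\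
    nth set0 (pairmap (fun u v => [set u; v]) x p) (index a s) = [set a; b].
  move=> aS bS ab; rewrite size_pairmap.
  have ap : (index a s < size p)%N by have := bS; rewrite -index_mem ab ltnS.
  split=> //; rewrite (nth_pairmap x) // -[nth x p _]/(nth x s (index a s).+1) -ab -/s.
  by rewrite !xi.
case/orP=> /eqP uv.
  by have [? E] := key v u vS uS uv; exists (index v s) => //; rewrite E setUC.
by have [? E] := key u v uS vS uv; exists (index u s).
Qed.

Variables (P : graph V) (s : seq V) (r : V -> nat).
Hypotheses (Ps : path_seq P s) (rP : ranked r P).

Let us : uniq s. Proof. by case: Ps. Qed.
Let Vs : vert P = [set:: s]. Proof. by case: Ps. Qed.
Let adjE : forall u v, adj P u v =
  [&& u \in s, v \in s &
     (index u s == (index v s).+1) || (index v s == (index u s).+1)].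
Proof. by case: Ps. Qed.

Lemma path_top_exists : vert P != set0 ->
  exists2 t, t \in vert P & forall v, ~~ up r P t v.
Proof.
case/set0Pn=> v0 v0P; pose t := [arg max_(i > v0 in vert P) r i].
have [tP tmax] : t \in vert P /\ forall u, u \in vert P -> (r u <= r t)%N.
  by rewrite /t; case: arg_maxnP.
exists t => // v; apply/negP => /andP[tv]; rewrite ltnNge tmax //.
exact: adj_vertr tv.
Qed.

Section Top.
Variable t : V.
Hypotheses (tP : t \in vert P) (topt : forall v, ~~ up r P t v).
Let i := index t s.

Let ts : t \in s. Proof. by move: tP; rewrite Vs inE. Qed.
Let g j := r (nth t s j).

Let adj_nth j : (j.+1 < size s)%N -> adj P (nth t s j) (nth t s j.+1).
Proof.
move=> js; have js' := ltnW js.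
by rewrite adjE !mem_nth // !index_uniq // eqxx orbT.
Qed.

Let g_neq j : (j.+1 < size s)%N -> g j != g j.+1.
Proof. by move=> js; apply: rP.1; apply: adj_nth. Qed.

(** The middle vertex would have two distinct parents. *)
Let no_valley j : (j.+2 < size s)%N -> (g j.+1 < g j)%N -> (g j.+1 < g j.+2)%N -> False.
Proof.
move=> js lo hi; have js' := ltnW js.
have := rP.2 (nth t s j.+1) (nth t s j) (nth t s j.+2).
rewrite /up adjC adj_nth // adj_nth // lo hi => /(_ isT isT)/eqP.
by rewrite nth_uniq // ?(ltnW js'); lia.
Qed.

Let descend_right j : (i <= j)%N -> (j.+1 < size s)%N -> (g j.+1 < g j)%N.
Proof.
elim: j => [|j IH] ij js.
  have i0 : i = 0%N by apply/eqP; rewrite -leqn0.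
  have := topt (nth t s 1); rewrite /up.
  have tE : t = nth t s 0 by rewrite -i0 /i nth_index.
  by rewrite {1}tE adj_nth //= {1}tE -leqNgt leq_eqVlt eq_sym (negbTE (g_neq js)).
have [ij'|ji] := leqP i j.
  rewrite ltnNge leq_eqVlt (negbTE (g_neq js)) /=; apply/negP => hi.
  by apply: (no_valley js) => //; apply: IH => //; apply: ltnW.
have ij1 : i = j.+1 by lia.
have := topt (nth t s j.+2); rewrite /up.
have tE : t = nth t s j.+1 by rewrite -ij1 /i nth_index.
by rewrite {1}tE adj_nth //= {1}tE -leqNgt leq_eqVlt eq_sym (negbTE (g_neq js)).
Qed.

Let ascend_left k : (k < i)%N -> (g (i - k.+1) < g (i - k))%N.
Proof.
have is_ : (i < size s)%N by rewrite /i index_mem.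
elim: k => [|k IH] ki.
  have := topt (nth t s (i - 1)); rewrite /up subn0.
  have E : i = (i - 1).+1 by lia.
  have tE : t = nth t s (i - 1).+1 by rewrite -E /i nth_index.
  have js : ((i - 1).+1 < size s)%N by rewrite -E.
  rewrite {1}tE adjC adj_nth //= {1}tE -leqNgt leq_eqVlt.
  by rewrite -!/(g _) (negbTE (g_neq js)) -E.
have E1 : (i - k = (i - k.+2).+2)%N by lia.
have E2 : (i - k.+1 = (i - k.+2).+1)%N by lia.
have js : ((i - k.+2).+2 < size s)%N by lia.
have := IH (ltnW ki); rewrite E1 E2 => lo.
rewrite ltnNge leq_eqVlt eq_sym (negbTE (g_neq (ltnW js))) /=; apply/negP => hi.
exact: (no_valley js).
Qed.

(* A path has no local minimum of the rank in its interior, so its ranks rise up to the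
   top and fall after it. *)
Lemma path_upE u v : up r P u v = [&& u \in s, v \in s &
  (index u s == (index v s).+1) && (i <= index v s)%N ||
  (index v s == (index u s).+1) && (index v s <= i)%N].
Proof.
rewrite /up adjE; case uS: (u \in s) => //=; case vS: (v \in s) => //=.
have gE w : w \in s -> r w = g (index w s) by move=> wS; rewrite /g nth_index.
have is_ : (i < size s)%N by rewrite /i index_mem.
have key a b : a \in s -> b \in s -> index b s = (index a s).+1 ->
    (r b < r a)%N = (i <= index a s)%N /\ (r a < r b)%N = (index b s <= i)%N.
  move=> aS bS ab; have bn : ((index a s).+1 < size s)%N by rewrite -ab index_mem.
  rewrite !gE // ab; have [ia|ai] := leqP i (index a s).
    by have := descend_right ia bn; split; lia.
  have := @ascend_left (i - (index a s).+1); rewrite (_ : i - (i - _).+1 = index a s)%N; last lia.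
  rewrite (_ : i - (i - (index a s).+1) = (index a s).+1)%N; last lia.
  by move=> /(_ ltac:(lia)) ?; split; lia.
case: eqP => [E|nE] /=.
  have [-> _] := key v u vS uS E.
  have -> : (index v s == (index u s).+1) = false by lia.
  by rewrite orbF.
by case: eqP => [E|] //=; have [_ ->] := key u v uS vS E.
Qed.

(** Ranks fall strictly on both sides of a parentless vertex, so it is the only one in the path. *)
Lemma path_top_gt u : u \in vert P -> u != t -> (r u < r t)%N.
Proof.
rewrite Vs inE => uS ut.
have gE w : w \in s -> r w = g (index w s) by move=> wS; rewrite /g nth_index.
have is_ : (i < size s)%N by rewrite /i index_mem.
have iu : index u s != i.
  by apply: contraNneq ut => E; rewrite -(nth_index t uS) E /i nth_index.
have := uS; rewrite -index_mem (gE u uS) (gE t ts) -/i.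
have right k : (i + k.+1 < size s)%N -> (g (i + k.+1) < g i)%N.
  elim: k => [|k IH] H.
    by have := @descend_right i (leqnn _); rewrite addn1 => -> //; lia.
  have := @descend_right (i + k.+1); rewrite -addnS => /(_ ltac:(lia) H).
  by move/ltn_trans; apply; apply: IH; lia.
have left k : (k < i)%N -> (g (i - k.+1) < g i)%N.
  elim: k => [|k IH] H.
    by have := @ascend_left 0 H; rewrite subn0.
  by apply: ltn_trans (ascend_left H) _; apply: IH; lia.
move=> un; case: (ltngtP (index u s) i) iu => // ui _.
  have E : (i - (i - (index u s).+1).+1 = index u s)%N by lia.
  by rewrite -E; apply: left; lia.
have E : (i + (index u s - i.+1).+1 = index u s)%N by lia.
by rewrite -E; apply: right; rewrite E.
Qed.

Lemma path_has_parent u : u \in vert P -> u != t -> exists v, up r P u v.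
Proof.
rewrite Vs inE => uS ut.
have is_ : (i < size s)%N by rewrite /i index_mem.
have un : (index u s < size s)%N by rewrite index_mem.
have iu : index u s != i.
  by apply: contraNneq ut => E; rewrite -(nth_index t uS) E /i nth_index.
case: (ltngtP (index u s) i) iu => // ui _.
  have vs : ((index u s).+1 < size s)%N by lia.
  exists (nth t s (index u s).+1); rewrite path_upE uS mem_nth // index_uniq //=.
  by rewrite eqxx ui orbT.
have vs : ((index u s).-1 < size s)%N by lia.
exists (nth t s (index u s).-1); rewrite path_upE uS mem_nth // index_uniq //=.
by apply/orP; left; lia.
Qed.

(** A vertex has at most two neighbours, and below the top one of them is the parent. *)
Lemma path_children v (C : pred V) :
  (#|[set u | up r P u v & C u]| <= 1 + (v == t))%N.
Proof.
have eqi u w : u \in s -> index u s = index w s -> u = w.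
  move=> uS E; have wS : w \in s by rewrite -index_mem -E index_mem.
  by rewrite -(nth_index t uS) E nth_index.
have [->|vt] := eqVneq v t.
  (* At an end of the path one of these two entries may be [t] itself; only the inclusion
     matters. *)
  have sub : [set u | up r P u t & C u] \subset [set nth t s i.+1; nth t s i.-1].
    apply/subsetP => u; rewrite !inE path_upE -/i => /andP[/and3P[uS _ H] _].
    have -> : u = nth t s (index u s) by rewrite nth_index.
    by case/orP: H => [/andP[/eqP-> _]|/andP[/eqP E _]]; rewrite ?E /= eqxx ?orbT.
  by apply: leq_trans (subset_leq_card sub) _; rewrite cards2; case: (_ != _).
apply/card_le1_eqP => u w; rewrite !inE !path_upE => /andP[/and3P[uS vS uH] _].
move=> /andP[/and3P[wS _ wH] _]; apply: eqi => //.
have iv : index v s <> i.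
  by move=> E; move: vt; rewrite -(nth_index t vS) E /i nth_index ?eqxx.
move: uH wH; lia.
Qed.

End Top.
End PathShape.

(** * Zeros against poles on one path *)

Section PathScore.
Variables (R : realType) (V : finType).
Implicit Types (G P : graph V) (s : seq V) (r : V -> nat) (u v t : V) (a : V -> option R).

Definition zeros G a : {set V} := [set v in vert G | a v == Some 0].
Definition poles G a : {set V} := [set v in vert G | a v == None].

Definition zero_children r G a v : {set V} := [set u | up r G u v & a u == Some 0].

(* Every zero other than the top is a child of a pole, and a pole has at most one child,
   or two when it is the top. *)
Lemma path_score P s r t a :
  path_seq P s -> ranked r P -> t \in vert P -> (forall v, ~~ up r P t v) ->
  (forall u v, up r P u v -> a u = Some 0 -> a v = None) ->
  (#|zeros P a| <= #|poles P a| + 1)%N /\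
  (#|zeros P a| = #|poles P a| + 1 ->
    (a t == Some 0%R) || (a t == None) /\
    forall v, v \in vert P -> a v = None -> #|zero_children r P a v| = 1 + (v == t))%N.
Proof.
move=> Ps rP tP topt aup.
pose k v := #|zero_children r P a v|.
have kle v : (k v <= 1 + (v == t))%N by apply: path_children Ps rP _ tP topt _ _.
(* Double counting: each zero below the top is charged to its parent, which is a pole. *)
have zle : (#|zeros P a| <= (a t == Some 0%R) + \sum_(v in poles P a) k v)%N.
  rewrite (cardsD1 t) inE tP /= leq_add2l -sum1_card.
  have par u : u \in zeros P a :\ t -> (1 <= \sum_(v in poles P a) up r P u v)%N.
    rewrite !inE => /and3P[ut uP /eqP u0].
    have [v uv] := path_has_parent Ps rP tP topt uP ut.
    rewrite (bigD1 v) /=; first by rewrite uv.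
    by rewrite inE (aup u v) // eqxx andbT; case/andP: uv => /adj_vertr.
  apply: (@leq_trans (\sum_(u in zeros P a :\ t) \sum_(v in poles P a) up r P u v)).
    exact: leq_sum.
  rewrite exchange_big /=; apply: leq_sum => v _.
  rewrite /k -sum1_card [leqRHS]big_mkcond [leqLHS]big_mkcond /=.
  apply: leq_sum => u _; rewrite !inE; case: (up _ _ _ _); case: (a u == _) => //=;
    by case: ifP; rewrite ?andbF.
have bsum : (\sum_(v in poles P a) (1 + (v == t)) = #|poles P a| + (a t == None))%N.
  rewrite big_split /= sum1_card; congr (_ + _)%N.
  rewrite -big_mkcondr /=.
  have [tN|tN] := boolP (a t == None).
    by rewrite (big_pred1 t) // => v /=; rewrite inE; case: (eqVneq v t) => [->|]; rewrite ?tP ?tN ?andbF.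
  by rewrite big_pred0 // => v; rewrite inE; case: (eqVneq v t) => [->|]; rewrite ?(negbTE tN) !andbF.
have ksum : (\sum_(v in poles P a) k v <= #|poles P a| + (a t == None))%N.
  by rewrite -bsum; apply: leq_sum => v _.
have ex : ((a t == Some 0%R) + (a t == None) <= 1)%N by case: (a t) => [x|] //=; case: (_ == _).
split; first by lia.
move=> E; split; first by case: (a t == Some 0) ex zle => //; case: (a t == None) ksum => //=; lia.
move=> v vP vN; apply/eqP; rewrite eqn_leq kle /=.
have vI : v \in poles P a by rewrite inE vP vN eqxx.
(* A pole with fewer zero children than allowed would make the total bound strict. *)
rewrite leqNgt; apply/negP => lt.
have : (\sum_(u in poles P a) k u < \sum_(u in poles P a) (1 + (u == t)))%N.
  rewrite (bigD1 v) //= [ltnRHS](bigD1 v) //= -addSn; apply: leq_add => //.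
  exact: leq_sum.
by rewrite bsum; lia.
Qed.

End PathScore.

(** * Essential and special vertices of a path *)

Section PathValues.
Variables (R : realType) (theta : R) (V : finType).
Implicit Types (P : graph V) (s : seq V) (r : V -> nat) (u v t : V).

(* Values along a path rooted at an end: [path_val k] is the value of the [k]-th vertex
   from the far end, and [path_val 0] is the infinity by which an absent child contributes 0. *)
Fixpoint path_val k : option R :=
  if k is k'.+1 then
    if path_val k' == Some 0 then None else Some (theta - oinv (path_val k'))
  else None.

Lemma rval_step_single G r v c (a : V -> option R) :
  (forall u, up r G u v = (u == c)) ->
  rval_step theta r G v a = if a c == Some 0 then None else Some (theta - oinv (a c)).
Proof.
move=> cv; rewrite /rval_step (big_pred1 c) //; congr (if _ then _ else _).
apply/existsP/idP => [[u]|c0]; first by rewrite cv => /andP[/eqP ->].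
by exists c; rewrite cv eqxx.
Qed.

Lemma rval_step_none G r v (a : V -> option R) :
  (forall u, up r G u v = false) -> rval_step theta r G v a = Some theta.
Proof.
move=> cv; rewrite /rval_step big_pred0 // subr0.
by case: existsP => // -[u]; rewrite cv.
Qed.

Section OnePath.
Variables (P : graph V) (s : seq V).
Hypothesis Ps : path_seq P s.

Let us : uniq s. Proof. by case: Ps. Qed.
Let inP v : (v \in vert P) = (v \in s). Proof. by case: Ps => _ -> _; rewrite inE. Qed.

Section Rooted.
Variables (r : V -> nat) (t : V).
Hypotheses (rP : ranked r P) (tP : t \in vert P) (topt : forall v, ~~ up r P t v).
Let i := index t s.
Let upE := path_upE Ps rP tP topt.

Lemma index_eq u v j : u \in s -> v \in s -> index u s = j -> index v s = j -> u = v.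
Proof. by move=> uS vS uj vj; rewrite -(nth_index t uS) uj -vj nth_index. Qed.

(** Right of the top, children lie further right, so the value depends only on the number of
    vertices from [v] to the right end, [v] included. *)
Lemma rval_right v : v \in s -> (i < index v s)%N ->
  rval theta r P v = path_val (size s - index v s).
Proof.
have [n] := ubnP (size s - index v s); elim: n v => // n IH v lt vS iv.
have vn : (index v s < size s)%N by rewrite index_mem.
have [js|js] := ltnP (index v s).+1 (size s).
  have cS := mem_nth t js; have ci : index (nth t s (index v s).+1) s = (index v s).+1.
    by rewrite index_uniq.
  rewrite rvalE (rval_step_single (c := nth t s (index v s).+1)).
    rewrite IH ?ci //; [|lia|lia].
    by rewrite (_ : size s - index v s = (size s - (index v s).+1).+1)%N //; lia.
  move=> u; rewrite upE vS /=; apply/idP/eqP => [/andP[uS H]|->].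
    by apply: (index_eq uS cS _ ci); move: H; rewrite -/i; lia.
  by rewrite cS ci -/i; lia.
rewrite (_ : size s - index v s = 1)%N /=; last by lia.
rewrite subr0 rvalE rval_step_none // => u; rewrite upE -/i.
apply/negP => /and3P[uS _]; have : (index u s < size s)%N by rewrite index_mem.
lia.
Qed.

Lemma rval_left v : v \in s -> (index v s < i)%N ->
  rval theta r P v = path_val (index v s).+1.
Proof.
have [n] := ubnP (index v s); elim: n v => // n IH v lt vS iv.
have vn : (index v s < size s)%N by rewrite index_mem.
case j0: (index v s) => [|j].
  rewrite /= subr0 rvalE rval_step_none // => u; rewrite upE -/i j0.
  by apply/negP => /and3P[uS _]; lia.
have jn : (j < size s)%N by lia.
have cS := mem_nth t jn; have ci : index (nth t s j) s = j by rewrite index_uniq.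
rewrite rvalE (rval_step_single (c := nth t s j)).
  by rewrite IH ?ci //; lia.
move=> u; rewrite upE vS /=; apply/idP/eqP => [/andP[uS H]|->].
  by apply: (index_eq uS cS _ ci); move: H; rewrite -/i j0; lia.
by rewrite cS ci -/i j0; lia.
Qed.

(** The two [path_val] terms are the values of the right and left neighbours seen from their ends.
    They do not involve the rank, which decides only which neighbours are children; this allows
    different ranks to be compared. *)
Lemma rval_poleE v : v \in s -> (rval theta r P v == None) =
  ((i <= index v s)%N && (path_val (size s - (index v s).+1) == Some 0)) ||
  ((index v s <= i)%N && (path_val (index v s) == Some 0)).
Proof.
move=> vS; have vn : (index v s < size s)%N by rewrite index_mem.
rewrite rvalE /rval_step; case: ifP => [/existsP[c]|no].
  rewrite upE vS /= -/i => /andP[/andP[cS /orP[]/andP[/eqP ci iv] /eqP c0]].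
    by rewrite iv -ci -rval_right ?c0 ?eqxx // ci; lia.
  by rewrite iv ci -rval_left ?c0 ?eqxx ?orbT //; lia.
(* Since [path_val 0] is infinity, a zero value on a side guarantees a neighbour there. *)
apply/esym/negP => /orP[]/andP[iv /eqP z].
  have js : ((index v s).+1 < size s)%N.
    by rewrite ltnNge -subn_eq0; apply/negP => /eqP z0; rewrite z0 in z.
  have cS := mem_nth t js; have ci := index_uniq t js us.
  have /existsP[] := negbT no; exists (nth t s (index v s).+1).
  by rewrite upE cS vS ci eqxx -/i iv /= rval_right ?ci ?z ?eqxx //; lia.
case j0 : (index v s) iv z => [|j] // iv z.
have js : (j < size s)%N by lia.
have cS := mem_nth t js; have ci := index_uniq t js us.
have /existsP[] := negbT no; exists (nth t s j).
by rewrite upE cS vS ci j0 eqxx -/i iv /= orbT rval_left ?ci ?z ?eqxx //; lia.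
Qed.

Lemma zero_children_top : #|zero_children r P (rval theta r P) t| = 2%N ->
  (path_val (size s - i.+1) == Some 0) && (path_val i == Some 0).
Proof.
have tS : t \in s by rewrite -inP.
have two u w : u \in zero_children r P (rval theta r P) t ->
    w \in zero_children r P (rval theta r P) t -> u != w ->
    (index u s < index w s)%N -> 
  (path_val (size s - i.+1) == Some 0) && (path_val i == Some 0).
  rewrite !inE !upE tS /= -/i => /andP[/andP[uS ui] /eqP u0] /andP[/andP[wS wi] /eqP w0] uw lt.
  have ui' : i = (index u s).+1 by lia.
  have wi' : index w s = i.+1 by lia.
  by rewrite {2}ui' -wi' -rval_right ?w0 ?wi' // -rval_left ?u0 ?ui' ?eqxx.
move=> /eqP c2; have /cards2P[u [w [uw E]]] := c2.
have uE : u \in zero_children r P (rval theta r P) t by rewrite E set21.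
have wE : w \in zero_children r P (rval theta r P) t by rewrite E set22.
have uS : u \in s by move: uE; rewrite inE upE => /andP[/and3P[]].
have wS : w \in s by move: wE; rewrite inE upE => /andP[/and3P[]].
case: (ltngtP (index u s) (index w s)) => [lt|lt|eq].
- exact: two uE wE uw lt.
- by rewrite eq_sym in uw; apply: two wE uE uw lt.
- by rewrite (index_eq uS wS eq erefl) eqxx in uw.
Qed.

(** The top is nobody's child, so no other value depends on it. *)
Lemma rval_del_top v : v != t -> rval theta r (del_vertex P t) v = rval theta r P v.
Proof.
have [n] := ubnP (r v); elim: n v => // n IH v; rewrite ltnS => rv vt.
rewrite !rvalE; transitivity (rval_step theta r (del_vertex P t) v (rval theta r P)).
  apply: eq_rval_step => c; rewrite up_del => /and3P[/andP[_ cv] ct _].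
  by apply: IH => //; apply: leq_trans rv.
have E c : up r (del_vertex P t) c v = up r P c v.
  rewrite up_del vt andbT; case: eqP => [->|]; rewrite ?andbT //.
  by rewrite andbF (negbTE (topt v)).
rewrite /rval_step; congr (if _ then _ else Some (_ - _)).
  by apply: eq_existsb => c; rewrite E.
by apply: eq_bigl => c; rewrite E.
Qed.

(** Deleting the top changes zeros minus poles only by the contribution of the top itself. *)
Lemma mult_del_top : mult theta P = 1%N ->
  essential theta P t = (rval theta r P t == Some 0).
Proof.
move=> m1.
have [_] := match_poly_rval theta rP; rewrite m1.
have [_] := match_poly_rval theta (subgraph_ranked (subgraph_del P t) rP).
have del (x : option R) : [set v in vert (del_vertex P t) | rval theta r (del_vertex P t) v == x]
    = [set v in vert P | rval theta r P v == x] :\ t.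
  apply/setP => v; rewrite [LHS]inE in_vert_del !inE.
  by case: (eqVneq v t) => //= vt; rewrite rval_del_top.
rewrite !del /essential tP m1 eqSS /=.
rewrite (cardsD1 t [set v in vert P | rval theta r P v == None]).
rewrite (cardsD1 t [set v in vert P | rval theta r P v == Some 0]).
rewrite !inE tP /=.
case: (rval theta r P t) => [x|] /=; last first.
  by have -> : (None == Some 0 :> option R) = false by []; lia.
by rewrite (inj_eq Some_inj); case: (x == 0) => /=; lia.
Qed.

End Rooted.

(** The rank is the length of the path minus the distance to [u]. *)
Lemma path_reroot u : u \in vert P -> exists r, ranked r P /\ forall v, ~~ up r P u v.
Proof.
case: Ps => _ Vs adjE; rewrite Vs inE => uS.
pose j := index u s; have jn : (j < size s)%N by rewrite index_mem.
exists (fun w => size s - ((index w s - j) + (j - index w s)))%N.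
have lts w : w \in s -> (index w s < size s)%N by rewrite index_mem.
split; last first.
  by move=> v; rewrite /up adjE; apply/negP => /andP[/and3P[_ /lts vn] +]; rewrite -/j; lia.
split=> [v w|v w z].
  by rewrite adjE => /and3P[/lts vn /lts wn +]; lia.
rewrite /up !adjE => /andP[/and3P[vS wS vw] lt1] /andP[/and3P[_ zS vz] lt2].
rewrite -(nth_index u wS) -(nth_index u zS); congr (nth _ _ _).
by have := lts v vS; have := lts w wS; have := lts z zS; lia.
Qed.

(** Rerooting at [u] reduces the claim to [mult_del_top]. Multiplicity 1 is the equality case of
    [path_score], so the value of [u] as a top is 0 or infinity, and in the latter case both its
    neighbours are zeros. *)
Lemma essential_rval r u : ranked r P -> mult theta P = 1%N -> u \in vert P ->
  essential theta P u = (rval theta r P u != None).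
Proof.
move=> rP m1 uP; have [r' [rP' topu]] := path_reroot uP.
have uS : u \in s by rewrite -inP.
have P0 : vert P != set0 by apply/set0Pn; exists u.
have [t tP topt] := path_top_exists r P0.
have [_] := match_poly_rval theta rP'; rewrite m1 addnC => /esym E.
have [_ /(_ E) [u0 kids]] := path_score Ps rP' uP topu (@rval_up R theta V r' P).
rewrite (mult_del_top rP' uP topu m1) (rval_poleE rP tP topt uS).
have := rval_poleE rP' uP topu uS; rewrite leqnn /=.
(* If [u] is no pole for [r'], neither side supplies a zero, so it is none for [r]. Otherwise both
   sides do, and [u] is a pole for [r] wherever the top of [r] lies. *)
have [uN|uN] := eqVneq (rval theta r' P u) None; last first.
  move=> /esym/norP[/negbTE-> /negbTE->]; rewrite !andbF /=.
  by move: u0; rewrite (negbTE uN) orbF => ->.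
have := kids u uP uN; rewrite eqxx addn1 => /(zero_children_top rP' uP topu) /andP[-> ->] _.
by rewrite uN /= !andbT leq_total.
Qed.

(** A pole is not essential but has a zero child, which is. *)
Lemma special_rval r u : ranked r P -> mult theta P = 1%N -> u \in vert P ->
  special theta P u = (rval theta r P u == None).
Proof.
move=> rP m1 uP; rewrite /special uP (essential_rval rP m1 uP) negbK /=.
have [uN|//] := eqVneq (rval theta r P u) None.
move: uN; rewrite rvalE /rval_step; case: ifP => // /existsP[c /andP[cu /eqP c0]] _ /=.
have ac : adj P c u by case/andP: cu.
apply/existsP; exists c; rewrite adjC ac (essential_rval rP m1) ?c0 //.
exact: adj_vertl ac.
Qed.

End OnePath.
End PathValues.

(** * Path covers *)

Section PathCover.
Variables (R : realType) (V : finType) (T : graph V) (Q : {set graph V}) (r : V -> nat).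
Hypotheses (rT : ranked r T) (TQ : path_cover T Q).
Implicit Types (P : graph V) (u v c : V) (theta : R).

Lemma cover_path P : P \in Q ->
  [/\ exists s, path_seq P s, subgraph P T, ranked r P & vert P != set0].
Proof.
move=> PQ; have [pP sP] := TQ.1 P PQ; split=> //.
- exact: path_graph_seq.
- exact: subgraph_ranked rT.
- by case: pP => x [p [_ -> _]]; apply/set0Pn; exists x; rewrite inE mem_head.
Qed.

Lemma cover_vert P v : P \in Q -> v \in vert P -> v \in vert T.
Proof. by move=> /cover_path[_ sP _ _]; apply: subgraph_vert. Qed.

Lemma cover_ex v : v \in vert T -> exists2 P, P \in Q & v \in vert P.
Proof. by move=> /TQ.2[P [[PQ vP] _]]; exists P. Qed.

Lemma cover_uniq P P' v : P \in Q -> P' \in Q -> v \in vert P -> v \in vert P' -> P = P'.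
Proof.
move=> PQ PQ' vP vP'; have [P0 [_ uP]] := TQ.2 v (cover_vert PQ vP).
by rewrite -(uP P) // -(uP P').
Qed.

Lemma card_cover (C : pred V) :
  #|[set v in vert T | C v]| = (\sum_(P in Q) #|[set v in vert P | C v]|)%N.
Proof.
have cE (A : {set V}) : #|[set v in A | C v]| = (\sum_v (v \in A) && C v)%N.
  rewrite -sum1dep_card big_mkcond; apply: eq_bigr => v _.
  by case: (_ && _).
rewrite cE (eq_bigr (fun P => \sum_v (v \in vert P) && C v)%N) => [|P _]; last exact: cE.
rewrite exchange_big; apply: eq_bigr => v _ /=.
have [vT|vT] := boolP (v \in vert T); last first.
  rewrite big1 // => P PQ; case vP: (v \in vert P) => //.
  by rewrite (cover_vert PQ vP) in vT.
have [P PQ vP] := cover_ex vT.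
rewrite (bigD1 P) //= vP big1 ?addn0 // => P' /andP[PQ' nP].
case vP': (v \in vert P') => //.
by rewrite (cover_uniq PQ' PQ vP' vP) eqxx in nP.
Qed.

(** If [c] is the top of [P], nothing in [P] ranks above it; otherwise its parent in [P] is its only
    parent in [T]. *)
Lemma cover_induced P c v :
  P \in Q -> c \in vert P -> v \in vert P -> up r T c v -> up r P c v.
Proof.
move=> PQ cP vP cv; have [[s Ps] sP rP P0] := cover_path PQ.
have [t tP topt] := path_top_exists r P0.
have [ct|ct] := eqVneq c t.
  have vt : v != t by rewrite -ct eq_sym; case/andP: cv => /adj_neq.
  have := path_top_gt Ps rP tP topt vP vt.
  by case/andP: cv => _; rewrite ct ltnNge => /negbTE lt /ltnW; rewrite lt.
have [w cw] := path_has_parent Ps rP tP topt cP ct.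
by rewrite (rT.2 _ _ _ cv (subgraph_up sP cw)).
Qed.

(** The only parent of [c] in [T] lies on another path. *)
Lemma cover_child_top P P' c v : P \in Q -> P' \in Q -> P != P' ->
  c \in vert P' -> v \in vert P -> up r T c v -> forall w, ~~ up r P' c w.
Proof.
move=> PQ PQ' PP' cP' vP cv w; apply/negP => cw.
have [_ sP' _ _] := cover_path PQ'.
have wv := rT.2 _ _ _ cv (subgraph_up sP' cw).
have vP' : v \in vert P' by rewrite wv; case/andP: cw => /adj_vertr.
by rewrite (cover_uniq PQ PQ' vP vP') eqxx in PP'.
Qed.

(** [path_score] is applied to the values computed in [T], not to those of the path alone. *)
Lemma cover_score theta P : P \in Q ->
  (#|zeros P (rval theta r T)| <= #|poles P (rval theta r T)| + 1)%N /\
  (#|zeros P (rval theta r T)| = #|poles P (rval theta r T)| + 1 ->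
   (forall t, t \in vert P -> (forall v, ~~ up r P t v) ->
      (rval theta r T t == Some 0%R) || (rval theta r T t == None)) /\
   forall v, v \in vert P -> rval theta r T v = None ->
     exists2 u, up r P u v & rval theta r T u = Some 0%R)%N.
Proof.
move=> PQ; have [[s Ps] sP rP P0] := cover_path PQ.
have aup u v : up r P u v -> rval theta r T u = Some 0 -> rval theta r T v = None.
  by move=> /(subgraph_up sP); apply: rval_up.
have [t tP topt] := path_top_exists r P0.
have [le kids] := path_score Ps rP tP topt aup.
split=> // E; have [_ tkids] := kids E; split.
  move=> t' tP' topt'; have [_ /(_ E)[]] := path_score Ps rP tP' topt' aup; by [].
move=> v vP vN; have := tkids v vP vN => cE.
have /card_gt0P[u] : (0 < #|zero_children r P (rval theta r T) v|)%N by rewrite cE.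
by rewrite inE => /andP[uv /eqP u0]; exists u.
Qed.

Lemma cover_mult theta : (mult theta T + \sum_(P in Q) #|poles P (rval theta r T)|
  = \sum_(P in Q) #|zeros P (rval theta r T)|)%N.
Proof. by have [_] := match_poly_rval theta rT; rewrite !card_cover. Qed.

Lemma mult_le_cover theta : (mult theta T <= #|Q|)%N.
Proof.
rewrite -(leq_add2r (\sum_(P in Q) #|poles P (rval theta r T)|)) cover_mult.
rewrite -sum1_card -big_split /=; apply: leq_sum => P PQ.
by rewrite addnC; case: (cover_score theta PQ).
Qed.

Lemma path_root_mult theta P : P \in Q -> root (match_poly R P) theta = (mult theta P == 1%N).
Proof.
move=> PQ; have [[s Ps] sP rP P0] := cover_path PQ.
have [m0 E] := match_poly_rval theta rP.
have [t tP topt] := path_top_exists r P0.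
have [le _] := path_score Ps rP tP topt (@rval_up R theta V r P).
rewrite -dvdp_XsubCl XsubC_dvd // -/(mult theta P).
move: le; rewrite /zeros -E addnC leq_add2l.
by case: (mult theta P) => [|[]].
Qed.

(** The induction on rank common to both directions. The premise concerns an edge from [c] up to [v]
    on another path, and may assume agreement at [c] and at the children of [v] in [P]. *)
Lemma rval_cover theta :
  (forall P P' c v, P \in Q -> P' \in Q -> P != P' -> c \in vert P' -> v \in vert P ->
     up r T c v -> rval theta r T c = rval theta r P' c ->
     (forall u, up r P u v -> rval theta r T u = rval theta r P u) ->
     (rval theta r P v == None) || (rval theta r T c == None)) ->
  forall P v, P \in Q -> v \in vert P -> rval theta r T v = rval theta r P v.
Proof.
move=> offpath P v; have [n] := ubnP (r v); elim: n P v => // n IH P v.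
rewrite ltnS => rv PQ vP; have [_ sP _ _] := cover_path PQ.
have IHP u : up r P u v -> rval theta r T u = rval theta r P u.
  case/andP=> uv ru; apply: IH => //; first exact: leq_trans ru rv.
  exact: adj_vertl uv.
(* A pole of the path has a zero child there, and by induction that child is also a zero in [T]. *)
have [vN|vN] := eqVneq (rval theta r P v) None.
  move: (vN); rewrite {1}rvalE /rval_step; case: ifP => // /existsP[c /andP[cv /eqP c0]] _.
  by rewrite vN (rval_up (subgraph_up sP cv)) // IHP.
(* Children on other paths are infinite, hence add 0 to the sum and create no pole. *)
have off c : up r T c v -> ~~ up r P c v -> rval theta r T c = None.
  move=> cv ncv; have [P' PQ' cP'] : exists2 P', P' \in Q & c \in vert P'.
    by apply: cover_ex; case/andP: cv => /adj_vertl.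
  have PP' : P != P'.
    apply: contraNneq ncv => PP'; apply: (cover_induced PQ) => //.
    by rewrite PP'.
  have cc : rval theta r T c = rval theta r P' c.
    by apply: IH => //; apply: leq_trans rv; case/andP: cv.
  by have := offpath P P' c v PQ PQ' PP' cP' vP cv cc IHP; rewrite (negbTE vN) => /eqP.
rewrite rvalE [RHS]rvalE -(eq_rval_step theta IHP) /rval_step.
congr (if _ then _ else Some (_ - _)).
  apply: eq_existsb => c; case cv: (up r P c v); first by rewrite (subgraph_up sP cv).
  by apply/negP => /andP[/off/(_ (negbT cv)) ->].
rewrite big_mkcond [RHS]big_mkcond; apply: eq_bigr => c _ /=.
case cv: (up r P c v); first by rewrite (subgraph_up sP cv).
by case: ifP => // /off/(_ (negbT cv)) ->.
Qed.

Lemma cover_card_poles_zeros theta P :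
  (forall v, v \in vert P -> rval theta r T v = rval theta r P v) -> ranked r P ->
  (mult theta P + #|poles P (rval theta r T)| = #|zeros P (rval theta r T)|)%N.
Proof.
move=> ab rP; have [_] := match_poly_rval theta rP.
have E x : [set v in vert P | rval theta r T v == x] = [set v in vert P | rval theta r P v == x].
  by apply/setP => v; rewrite !inE; case vP: (v \in vert P); rewrite //= ab.
by rewrite -!E.
Qed.

(** By [special_rval], condition (b) of extremality supplies the premise of [rval_cover]; each path
    then contributes its own multiplicity 1. *)
Lemma extremal_mult theta : extremal theta T Q -> mult theta T = #|Q|.
Proof.
case=> rootQ spQ.
have m1 P : P \in Q -> mult theta P = 1%N.
  by move=> PQ; apply/eqP; rewrite -path_root_mult // rootQ.
have ab : forall P v, P \in Q -> v \in vert P -> rval theta r T v = rval theta r P v.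
  apply: rval_cover => P P' c v PQ PQ' PP' cP' vP /andP[cv _] -> _.
  have [[s Ps] _ rP _] := cover_path PQ; have [[s' Ps'] _ rP' _] := cover_path PQ'.
  rewrite -(special_rval Ps rP (m1 P PQ) vP) -(special_rval Ps' rP' (m1 P' PQ') cP').
  by apply: (spQ P P' v c) => //; rewrite adjC.
apply/eqP; rewrite -(eqn_add2r (\sum_(P in Q) #|poles P (rval theta r T)|)) cover_mult.
rewrite -sum1_card -big_split /=; apply/eqP; apply: eq_bigr => P PQ.
have [_ _ rP _] := cover_path PQ.
by rewrite -(cover_card_poles_zeros _ rP) ?(m1 P PQ) // => v; apply: ab.
Qed.

Lemma mult_extremal theta : mult theta T = #|Q| -> extremal theta T Q.
Proof.
move=> mQ.
have score1 P : P \in Q ->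
    #|zeros P (rval theta r T)| = (#|poles P (rval theta r T)| + 1)%N.
  (* A deficit on one path cannot be made up by the others, each contributing at most 1. *)
  move=> PQ; apply/eqP; rewrite eqn_leq (cover_score theta PQ).1 /= leqNgt; apply/negP => lt.
  have := cover_mult theta; rewrite mQ -sum1_card -big_split /= (bigD1 P) //=.
  rewrite [RHS](bigD1 P) //= => E.
  have : (\sum_(P' in Q | P' != P) #|zeros P' (rval theta r T)| <=
    \sum_(P' in Q | P' != P) (1 + #|poles P' (rval theta r T)|))%N.
    apply: leq_sum => P' /andP[PQ' _]; rewrite addnC.
    by case: (cover_score theta PQ').
  move=> le; have := leq_add lt le.
  by rewrite addSn -E [(_ + 1)%N]addnC ltnn.
have top_val P t : P \in Q -> t \in vert P -> (forall v, ~~ up r P t v) ->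
    rval theta r T t = Some 0 \/ rval theta r T t = None.
  move=> PQ tP topt; have [_ /(_ (score1 P PQ)) [+ _]] := cover_score theta PQ.
  by move=> /(_ t tP topt) /orP[]/eqP; [left|right].
have ab : forall P v, P \in Q -> v \in vert P -> rval theta r T v = rval theta r P v.
  apply: rval_cover => P P' c v PQ PQ' PP' cP' vP cv _ abv.
  case: (top_val P' c PQ' cP' (cover_child_top PQ PQ' PP' cP' vP cv)) => [c0|->]; last first.
    by rewrite orbT.
  (* A zero [c] makes [v] infinite in [T]; equality on [P] yields a zero child of [v] inside [P], so
     [v] is already infinite there. *)
  have [_ /(_ (score1 P PQ)) [_ kids]] := cover_score theta PQ.
  have [u uv u0] := kids v vP (rval_up cv c0).
  by rewrite (rval_up uv) // -abv.
have m1 P : P \in Q -> mult theta P = 1%N.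
  move=> PQ; have [_ _ rP _] := cover_path PQ.
  have := cover_card_poles_zeros (fun v => ab P v PQ) rP.
  by rewrite score1 // addnC => /addnI.
split=> [P PQ|P P' u v PQ PQ' PP' uP vP' uv]; first by rewrite path_root_mult // m1.
have [[s Ps] _ rP _] := cover_path PQ; have [[s' Ps'] _ rP' _] := cover_path PQ'.
rewrite (special_rval Ps rP (m1 P PQ) uP) (special_rval Ps' rP' (m1 P' PQ') vP').
rewrite -!ab //.
have P'P : P' != P by rewrite eq_sym.
(* The lower end of the edge tops its path, so its value is infinity, or it is 0 and makes the upper
   end infinite. *)
case: (ltngtP (r u) (r v)) (rT.1 _ _ uv) => // ruv _.
  have uv' : up r T u v by rewrite /up uv.
  case: (top_val P u PQ uP (cover_child_top PQ' PQ P'P uP vP' uv')) => [u0|-> //].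
  by rewrite (rval_up uv') // orbT.
have vu' : up r T v u by rewrite /up adjC uv.
case: (top_val P' v PQ' vP' (cover_child_top PQ PQ' PP' vP' uP vu')) => [v0|->]; last first.
  by rewrite orbT.
by rewrite (rval_up vu').
Qed.

End PathCover.

Theorem theorem1p7 (R : realType) (V : finType) (T : graph V)
    (Q : {set graph V}) (m : nat) (theta : R) :
  is_tree T -> path_cover T Q -> #|Q| = m ->
  (max_root_mult (match_poly R T) m /\
   root (match_poly R T) theta /\ mult theta T = m)
  <-> extremal theta T Q.
Proof.
move=> [[/set0Pn[v vT] _] acT] TQ <-; have [r rT] := acyclic_ranked acT.
split=> [[_ [_ mQ]]|ext]; first exact: (mult_extremal rT TQ).
have mQ := extremal_mult rT TQ ext.
(* A tree has a vertex, so the multiplicity is positive and [theta] is a root. *)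
have Q0 : (0 < #|Q|)%N.
  by have [P PQ _] := cover_ex TQ vT; apply/card_gt0P; exists P.
have rootT : root (match_poly R T) theta.
  by rewrite -dvdp_XsubCl XsubC_dvd ?(match_poly_rval theta rT).1 // -/(mult theta T) mQ.
split=> //; split=> [|t _]; first by exists theta.
exact: (mult_le_cover rT TQ).
Qed.
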